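(* For every $n\in\mathbb{N}$, $F(n)\le\sqrt{n+1}$, and equality holds if and only if $n=f_r^2-1$ for some $r\in\mathbb{N}$.
   Context: $f_0=f_1=1$, $f_i=f_{i-1}+f_{i-2}$ ($i\ge2$). A Fibonacci partition of $n\in\mathbb{N}$ is a finite set $\{f_{i_1},\dots,f_{i_h}\}$ with $1\le i_1<\dots<i_h$ and $f_{i_1}+\dots+f_{i_h}=n$ (the empty set for $n=0$); $F(n)$ is the number of Fibonacci partitions of $n$, i.e. $\prod_{i\ge1}(1+x^{f_i})=\sum_{n\ge0}F(n)x^n$. *)

(* Defs.v *)
From HB Require Import structures.
From mathcomp Require Import all_boot all_order all_algebra finmap.

Set Implicit Arguments.
Unset Strict Implicit.
Unset Printing Implicit Defensive.

Local Open Scope fset_scope.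
Local Open Scope nat_scope.


Fixpoint fib (n : nat) : nat :=
  match n with
  | 0 => 1
  | 1 => 1
  | (m.+1 as k).+1 => fib k + fib m
  end.

Lemma fibSS i : fib i.+2 = fib i.+1 + fib i.
Proof. by []. Qed.

Lemma fib_gt0 i : 0 < fib i.
Proof.
suff: (0 < fib i) && (0 < fib i.+1) by case/andP.
by elim: i => // i /andP[h1 h2]; rewrite fibSS addn_gt0 h2.
Qed.

Lemma fib_ge i : i <= fib i.
Proof.
suff: (i <= fib i) && (i.+1 <= fib i.+1) by case/andP.
elim: i => // i /andP[h1 h2]; rewrite h2 fibSS.
by rewrite -[i.+2]addn1 leq_add ?fib_gt0.
Qed.

(* The search bound [i <= x] loses nothing, since [i <= fib i]; see [is_fibP]. *)
Definition is_fib (x : nat) : bool :=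
  [exists i : 'I_x.+1, (0 < i) && (x == fib i)].

Lemma is_fibP x : reflect (exists2 i, 0 < i & x = fib i) (is_fib x).
Proof.
apply: (iffP existsP) => [[i /andP[i0 /eqP ->]]|[i i0 xE]]; first by exists i.
have ix : i < x.+1 by rewrite ltnS xE fib_ge.
by exists (Ordinal ix); rewrite /= i0 xE eqxx.
Qed.

Definition fib_partition (n : nat) (A : {fset nat}) : bool :=
  all is_fib A && (\sum_(x <- A) x == n).

(* The elements of a partition of [n] are at most [n], so restricting to subsets
   of {0, ..., n} loses nothing; see [in_fib_partitions]. *)
Definition fib_partitions (n : nat) : {fset {fset nat}} :=
  [fset A in fpowerset [fset x in iota 0 n.+1] | fib_partition n A].

Lemma in_fib_partitions n (A : {fset nat}) : (A \in fib_partitions n) = fib_partition n A.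
Proof.
rewrite !inE /= andb_idl // => /andP[_ /eqP sA].
rewrite fpowersetE; apply/fsubsetP => x xA.
have xn : x <= n by rewrite -sA (big_rem x) //= leq_addr.
by rewrite in_fset; change (x \in iota 0 n.+1); rewrite mem_iota.
Qed.

Definition F (n : nat) : nat := #|` fib_partitions n|.

(* Main.v *)
(** Put [H m = F (m - 1)] and [H 0 = 0].  Complementing subsets of
    {f_1, ..., f_k} gives [H (f_(k+1) + a) = H a + H b] whenever [a + b = f_k].
    If [H a = x] and [H b = y] with [x^2 <= a] and [y^2 <= b], then with [P = f_k]
    and [q = f_(k+1) - f_k] the bound [(x + y)^2 <= f_(k+1) + a] follows from
    [4ab <= (q + a)^2], and
    [5 ((q + a)^2 - 4ab) = (5a - 2P + q)^2 - 4 (P^2 - Pq - q^2)] is at least -4 by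
    Cassini, hence nonnegative.  Equality forces [P = x^2 + y^2] and
    [q = 2xy - x^2], so that [(y^2 - xy - x^2)^2 = P^2 - Pq - q^2 = 1] and [x], [y]
    are consecutive Fibonacci numbers.  Conversely
    [f_r^2 = f_(2r-1) + f_(r-2)^2] and [f_(r-2)^2 + f_(r-1)^2 = f_(2r-2)]. *)

Require Import Defs.
From mathcomp Require Import all_boot all_order all_algebra finmap zify ring.

Import Order.TTheory GRing.Theory Num.Theory.

(** * Counting subsets with a given sum *)

Section SubsetSums.
Local Open Scope fset_scope.
Local Open Scope nat_scope.

Definition subset_sums (S : {fset nat}) (n : nat) : {fset {fset nat}} :=
  [fset A in fpowerset S | \sum_(x <- A) x == n].

Lemma in_subset_sums S n (A : {fset nat}) :
  (A \in subset_sums S n) = (A `<=` S) && (\sum_(x <- A) x == n).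
Proof. by rewrite !inE /= fpowersetE. Qed.

Lemma card_subset_sums0 n : #|` subset_sums fset0 n| = (n == 0).
Proof.
case: n => [|n] /=; last first.
  apply/eqP; rewrite cardfs_eq0; apply/eqP/fsetP => A.
  rewrite in_subset_sums fsubset0 in_fset0.
  by apply/negP => /andP[/eqP-> /eqP]; rewrite big_seq_fset0.
rewrite -(cardfs1 (fset0 : {fset nat})); congr #|` _|; apply/fsetP => A.
rewrite in_subset_sums fsubset0 in_fset1 andb_idr // => /eqP->.
by rewrite big_seq_fset0.
Qed.

(** Split by membership of [a]; deleting [a] maps the subsets containing it bijectively to the
    subsets of [S] with sum [n - a]. *)
Lemma card_subset_sumsU1 a S n : a \notin S ->
  #|` subset_sums (a |` S) n| =
  #|` subset_sums S n| + (if a <= n then #|` subset_sums S (n - a)| else 0).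
Proof.
move=> aS; have aA A m : A \in subset_sums S m -> a \notin A.
  rewrite in_subset_sums => /andP[/fsubsetP AS _].
  by apply/negP => /AS; rewrite (negPf aS).
set T := if a <= n then [fset a |` A | A in subset_sums S (n - a)] else fset0.
have -> : subset_sums (a |` S) n = subset_sums S n `|` T.
  apply/fsetP => A; rewrite in_fsetU !in_subset_sums.
  have [aInA|aNA] := boolP (a \in A); last first.
    have -> : (A \in T) = false.
      apply/negbTE; apply: contra aNA; rewrite /T; case: ifP => // _.
      by case/imfsetP => B /= _ ->; rewrite fset1U1.
    rewrite orbF; congr andb; apply/fsubsetP/fsubsetP => sA x xA.
      move: (sA x xA); rewrite in_fset1U => /orP[/eqP xa|//].
      by rewrite -xa xA in aNA.
    by rewrite in_fset1U sA ?orbT.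
  have -> : (A `<=` S) = false.
    by apply/negP => /fsubsetP/(_ a aInA); rewrite (negPf aS).
  have eA : a |` (A `\ a) = A by rewrite fsetD1K.
  have aD : a \notin A `\ a by rewrite !inE eqxx.
  have sumA : \sum_(x <- A) x = a + \sum_(x <- A `\ a) x.
    by rewrite -{1}eA big_fsetU1.
  have subA : (A `<=` a |` S) = (A `\ a `<=` S) by rewrite fsubDset.
  rewrite /= subA sumA /T; case: leqP => [an|na]; last first.
    by rewrite in_fset0 gtn_eqF ?andbF // ltn_addr.
  apply/idP/imfsetP => /= [/andP[sA sE]|[B BS AE]].
    by exists (A `\ a) => //; rewrite in_subset_sums sA -(eqP sE) addKn eqxx.
  have := aA _ _ BS; rewrite AE => aB.
  by move: BS; rewrite fsetU1K // in_subset_sums => /andP[-> /eqP->]; rewrite subnKC ?eqxx.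
rewrite cardfsU (_ : _ `&` T = fset0) ?cardfs0 ?subn0; last first.
  apply/fsetP => A; rewrite in_fsetI in_fset0; apply/negP => /andP[/aA aNA].
  rewrite /T; case: ifP => // _ /imfsetP[B /= _ AE].
  by rewrite AE fset1U1 in aNA.
congr addn; rewrite /T; case: ifP => // _; apply: card_in_imfset => A B.
by move=> /aA aNA /aA aNB /= AB; rewrite -(fsetU1K aNA) AB fsetU1K.
Qed.

(** * Fibonacci partitions and their recurrence *)

Fixpoint fibs (k : nat) : {fset nat} :=
  if k is j.+1 then fib k |` fibs j else fset0.

Lemma fib_leq i j : i <= j -> fib i <= fib j.
Proof.
apply: (homo_leq leqnn leq_trans) => -[//|k].
by rewrite fibSS leq_addr.
Qed.

Lemma fib_ltn i j : 0 < i < j -> fib i < fib j.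
Proof.
case/andP => i0 ij; apply: leq_trans (fib_leq _ _ ij).
by case: i i0 {ij} => // i _; rewrite fibSS -[X in X < _]addn0 ltn_add2l fib_gt0.
Qed.

Lemma in_fibs k x : reflect (exists2 i, 0 < i <= k & x = fib i) (x \in fibs k).
Proof.
elim: k x => [|k IH] x; first by rewrite in_fset0; constructor; case=> -[|].
rewrite [fibs _]/= in_fset1U.
apply: (iffP orP) => [[/eqP->|/IH[i ik ->]]|[i ik ->]].
- by exists k.+1; rewrite ?leqnn.
- by exists i => //; lia.
have [->|ne] := eqVneq i k.+1; first by left.
by right; apply/IH; exists i => //; lia.
Qed.

Lemma fibsS_notin k : fib k.+1 \notin fibs k.
Proof.
apply/negP => /in_fibs[i ik fE]; have : fib i < fib k.+1 by apply: fib_ltn; lia.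
by rewrite fE ltnn.
Qed.

Lemma F_subset_sums k n : n < fib k.+1 -> F n = #|` subset_sums (fibs k) n|.
Proof.
move=> nk; congr #|` _|; apply/fsetP => A.
rewrite in_fib_partitions in_subset_sums /fib_partition.
have [/eqP sA|] := boolP (_ == n); rewrite ?andbT ?andbF //.
apply/allP/fsubsetP => sub x xA; last first.
  by have /in_fibs[i /andP[i0 _] ->] := sub x xA; apply/is_fibP; exists i.
have /is_fibP[i i0 xE] := sub x xA; apply/in_fibs; exists i => //.
have xn : x <= n by rewrite -sA (big_rem x) //= leq_addr.
rewrite i0 leqNgt; apply/negP => /fib_leq; rewrite -xE; lia.
Qed.

Lemma card_subset_sums_fibsS k n :
  #|` subset_sums (fibs k.+1) n| = #|` subset_sums (fibs k) n| +
    (if fib k.+1 <= n then #|` subset_sums (fibs k) (n - fib k.+1)| else 0).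
Proof. exact: card_subset_sumsU1 (fibsS_notin k). Qed.

(** Here [n] exceeds [fib k.+2 - 2], the sum of all of [fibs k]. *)
Lemma card_subset_sums_large k n :
  fib k.+2 < n + 2 -> #|` subset_sums (fibs k) n| = 0.
Proof.
elim: k n => [|k IH] n nk.
  by rewrite card_subset_sums0; case: n nk.
have := fib_gt0 k.+1; have := fib_gt0 k.
rewrite fibSS in nk; rewrite card_subset_sums_fibsS => ? ?.
rewrite IH; last lia.
by case: ifP => // kn; rewrite IH //; lia.
Qed.

(* Complementation: the elements of [fibs k] add up to [fib k.+2 - 2]. *)
Lemma card_subset_sums_compl k n m : n + m + 2 = fib k.+2 ->
  #|` subset_sums (fibs k) n| = #|` subset_sums (fibs k) m|.
Proof.
elim: k n m => [|k IH] n m nm.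
  have [-> ->] : n = 0 /\ m = 0 by move: nm => /=; lia.
  by [].
rewrite fibSS in nm.
rewrite (card_subset_sums_fibsS k n) (card_subset_sums_fibsS k m).
(* Complementation exchanges the subsets that contain [fib k.+1] with those that omit it. If
   [a < fib k.+1], then [b] is too large and both counts vanish. *)
have half a b : a + b + 2 = fib k.+2 + fib k.+1 ->
    (if fib k.+1 <= a then #|` subset_sums (fibs k) (a - fib k.+1)| else 0)
    = #|` subset_sums (fibs k) b|.
  move=> ab; case: leqP => ka; first by apply: IH; lia.
  by rewrite card_subset_sums_large //; lia.
by rewrite (half n m nm) (half m n) ?[m + n]addnC // addnC.
Qed.

(* [F] shifted by one, with value 0 at 0; the shift makes the recurrence
   [Fpred_rec] and the bound [Fpred_sqr_le] homogeneous. *)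
Definition Fpred (m : nat) : nat := if m is n.+1 then F n else 0.

(** Partitions using [fib k.+1] leave [a - 1] to be partitioned; the others are subsets of [fibs k],
    and their complements there have sum [b - 1]. When [a] or [b] is 0, the corresponding class is
    empty. *)
Lemma Fpred_rec k a b :
  a + b = fib k -> Fpred (fib k.+1 + a) = Fpred a + Fpred b.
Proof.
move=> ab; have fk := fib_gt0 k; have fk1 := fib_gt0 k.+1.
have fle : fib k <= fib k.+1 by apply: fib_leq.
have fE := fibSS k.
case E: (fib k.+1 + a) => [|n] /=; first lia.
rewrite (F_subset_sums k.+1); last lia.
rewrite card_subset_sums_fibsS addnC; congr addn.
  case: a ab E => [|a] ab E; first by rewrite ifN // -ltnNge; lia.
  rewrite /Fpred (F_subset_sums k); last lia.
  by rewrite ifT; first congr #|` subset_sums _ _|; lia.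
case: b ab => [|b] ab; first by apply: card_subset_sums_large; lia.
rewrite /Fpred (F_subset_sums k); last lia.
by apply: card_subset_sums_compl; lia.
Qed.

Lemma fib_split m : 0 < m -> exists k a b, a + b = fib k /\ m = fib k.+1 + a.
Proof.
move=> m0; have ex : exists k, m <= fib k.+1.
  by exists m; apply: leq_trans (fib_ge _) (fib_leq _ _ (leqnSn m)).
(* Minimality places [m] between consecutive Fibonacci numbers, except for [m = 1], which is split
   with [a = 0] and [b = 1]. *)
case: (ex_minnP ex) => -[|k] mk kmin.
  by exists 0, 0, 1; rewrite /= in mk *; split=> //; lia.
have lt : fib k.+1 < m by rewrite ltnNge; apply/negP => /kmin; rewrite ltnn.
exists k, (m - fib k.+1), (fib k.+2 - m); have := fibSS k; lia.
Qed.

Lemma F0 : F 0 = 1.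
Proof. by rewrite (F_subset_sums 0) // card_subset_sums0. Qed.

Lemma fib_double i : fib (i.*2).+2 = fib i.+1 ^ 2 + fib i ^ 2
  /\ fib (i.*2).+3 = fib i.+1 ^ 2 + 2 * fib i.+1 * fib i.
Proof.
elim: i => // i [e o]; rewrite doubleS.
have e' : fib (i.*2).+4 = fib i.+2 ^ 2 + fib i.+1 ^ 2.
  by rewrite fibSS o e fibSS; ring.
by split=> //; rewrite fibSS e' o fibSS; ring.
Qed.

Lemma Fpred_fib_sqr r : Fpred (fib r ^ 2) = fib r.
Proof.
suff: Fpred (fib r ^ 2) = fib r /\ Fpred (fib r.+1 ^ 2) = fib r.+1 by case.
elim: r => [|r [IH1 IH2]]; first by rewrite /= F0.
split=> //; have [e o] := fib_double r.
have -> : fib r.+2 ^ 2 = fib (r.*2).+3 + fib r ^ 2 by rewrite o fibSS; ring.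
rewrite (Fpred_rec _ _ (fib r.+1 ^ 2)); last by rewrite e addnC.
by rewrite IH1 IH2 addnC.
Qed.
End SubsetSums.

(** * The upper bound and its equality case *)

Local Open Scope ring_scope.

(** Passing from [k] to [k.+1] replaces [(P, q)] by [(P + q, P)], which negates the form. *)
Lemma fib_cassini k (P := (fib k)%:Z) (q := (fib k.+1)%:Z - P) :
  P ^+ 2 - P * q - q ^+ 2 = 1 \/ P ^+ 2 - P * q - q ^+ 2 = -1.
Proof.
rewrite {}/q {}/P; elim: k => [|k IH]; first by left.
by rewrite fibSS PoszD; nia.
Qed.

(** This bounds the cross term of [(x + y) ^ 2]; adding the bounds on the two squares gives at most
    [P + q + a]. *)
Lemma fib_split_bound (P q a b x y : int) :
    P ^+ 2 - P * q - q ^+ 2 = 1 \/ P ^+ 2 - P * q - q ^+ 2 = -1 ->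
    0 <= q -> 0 <= x -> 0 <= y -> x ^+ 2 <= a -> y ^+ 2 <= b -> a + b = P ->
  2 * x * y <= q + a.
Proof.
move=> cas q0 x0 y0 xa yb abP.
have a0 : 0 <= a by apply: le_trans xa; rewrite sqr_ge0.
have key : 4 * a * b <= (q + a) ^+ 2.
  (* The left-hand side below is a multiple of 5 and the right-hand side is at
     least -4. *)
  have : 5 * ((q + a) ^+ 2 - 4 * a * b)
       = (5 * a - 2 * P + q) ^+ 2 - 4 * (P ^+ 2 - P * q - q ^+ 2).
    by rewrite -abP; ring.
  have := sqr_ge0 (5 * a - 2 * P + q); lia.
have xyab : x ^+ 2 * y ^+ 2 <= a * b.
  by apply: ler_pM; rewrite ?sqr_ge0.
rewrite -(ler_pXn2r (n := 2)) ?nnegrE ?mulr_ge0 ?addr_ge0 //.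
apply: le_trans key; have -> : (2 * x * y) ^+ 2 = 4 * (x ^+ 2 * y ^+ 2) by ring.
lia.
Qed.

(** Descent: replacing [(x, y)] by [(y - x, x)] negates the form and ends at [x = 0] or [x = y],
    where [y = 1]. *)
Lemma fib_of_norm1 (x y : nat) : (0 < y)%N ->
  (y%:Z ^+ 2 - x%:Z * y%:Z - x%:Z ^+ 2) ^+ 2 = 1 ->
  exists r, y = fib r /\ (x + y)%N = fib r.+1.
Proof.
elim/ltn_ind: y x => y IH x y0 nrm.
have N1 : y%:Z ^+ 2 - x%:Z * y%:Z - x%:Z ^+ 2 = 1 \/
    y%:Z ^+ 2 - x%:Z * y%:Z - x%:Z ^+ 2 = -1.
  by apply/pred2P; rewrite -sqrf_eq1; apply/eqP.
have xy : (x <= y)%N by rewrite leqNgt; apply/negP => yx; nia.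
have [x0|x0] := posnP x.
  by exists 0%N; move: nrm; rewrite x0 => nrm; split=> /=; nia.
have [yx|yx] := eqVneq y x.
  by exists 1%N; rewrite /=; split; nia.
have xlty : (x < y)%N by lia.
have [|r [xr yr]] := IH x xlty (y - x)%N x0.
  rewrite -nrm -subzn //; ring.
exists r.+1; rewrite fibSS -xr -yr; split; lia.
Qed.

Lemma Fpred_sqr_le m : (Fpred m ^ 2 <= m)%N /\
  ((0 < m)%N -> (Fpred m ^ 2)%N = m -> exists r, Fpred m = fib r).
Proof.
elim/ltn_ind: m => m IH.
have [->|m0] := posnP m; first by [].
(* The split of 1 has [b = 1], so induction would not descend. *)
have [->|m1] := eqVneq m 1%N; first by rewrite /= F0; split=> // _ _; exists 0%N.
have [k [a [b [ab mE]]]] := fib_split m m0.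
have fk : (fib k <= fib k.+1)%N by apply: fib_leq.
have fk0 := fib_gt0 k.
have am : (a < m)%N by lia.
have bm : (b < m)%N.
  have [a0|] := posnP a; last lia.
  case: k ab mE {fk fk0} => [|k] ab mE; first by rewrite /= in ab mE; lia.
  by have := fib_gt0 k; rewrite fibSS in mE; lia.
have [xa _] := IH a am; have [yb _] := IH b bm.
rewrite mE (Fpred_rec _ _ b) //; move: (Fpred a) (Fpred b) xa yb => x y xa yb.
have bound : 2 * x%:Z * y%:Z <= (fib k.+1)%:Z - (fib k)%:Z + a%:Z.
  apply: (fib_split_bound (fib k)%:Z _ a%:Z b%:Z) => //; try lia.
  exact: fib_cassini.
split=> [|_ eqm]; first nia.
(* The bound on [(x + y) ^ 2] is the sum of three inequalities, so equality holds in each. *)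
have xE : (x ^ 2)%N = a by nia.
have yE : (y ^ 2)%N = b by nia.
have PE : (fib k)%:Z = x%:Z ^+ 2 + y%:Z ^+ 2 by nia.
have qE : (fib k.+1)%:Z - (fib k)%:Z = 2 * x%:Z * y%:Z - x%:Z ^+ 2 by nia.
have y0 : (0 < y)%N by rewrite lt0n; apply/eqP => y0; nia.
have [|r [_ ->]] := fib_of_norm1 x y y0; last by exists r.+1.
have := fib_cassini k; cbv zeta; rewrite qE PE.
(* The Cassini form at [(P, q)] is the square of the same form at [(y, x)], which excludes the value
   -1. *)
set N := _ - _ - _; have -> : N = (y%:Z ^+ 2 - x%:Z * y%:Z - x%:Z ^+ 2) ^+ 2.
  by rewrite /N; ring.
by case=> // Nneg; have := sqr_ge0 (y%:Z ^+ 2 - x%:Z * y%:Z - x%:Z ^+ 2); rewrite Nneg.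
Qed.

Theorem theorem4p5 (R : rcfType) (n : nat) :
  (F n)%:R <= Num.sqrt (n%:R + 1) :> R /\
  ((F n)%:R = Num.sqrt (n%:R + 1) :> R <->
   exists r : nat, n = (fib r ^ 2 - 1)%N).
Proof.
have [le eq] := Fpred_sqr_le n.+1.
have -> : (F n)%:R = Num.sqrt (F n ^ 2)%:R :> R by rewrite natrX sqrtr_sqr ger0_norm.
rewrite natr1 ler_sqrt ?ler0n // ler_nat; split=> //; split=> [|[r nE]].
  move/eqP; rewrite eqr_sqrt ?ler0n // eqr_nat => /eqP FE.
  have [//|//|r Fr] := eq; exists r; rewrite /= in Fr; rewrite -Fr FE; lia.
(* Positivity of [fib r] makes the truncated subtraction exact. *)
have fr := fib_gt0 r; have n1 : n.+1 = (fib r ^ 2)%N by nia.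
by rewrite n1 -(Fpred_fib_sqr r) -n1.
Qed.
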